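(* Let $r,f_1,\dots,f_n,g_1,\dots,g_n:\mathbb{R}^d\to\mathbb{R}\cup\{\infty\}$ be convex, closed, and proper. Assume $f_1,\dots,f_n$ are differentiable and have $L$-Lipschitz continuous gradients. Assume the Lagrangian $\mathcal{L}$ (defined in the context) has a saddle point, and let $0<\alpha<3/(2L)$. Let the iterates be generated by the method (PPG) of the context from an arbitrary starting point $\mathbf{z}^0\in\mathbb{R}^{dn}$, and let $x^\star$ be a solution of $\text{minimize}_{x}\; r(x)+\frac1n\sum_{i=1}^n (f_i(x)+g_i(x))$. With the ergodic quantities $E^k_{\mathrm{erg}}$, $e^k_{\mathrm{erg}}$ defined in the context, $$|E^k_{\mathrm{erg}}|\le\mathcal{O}(1/k).$$ If, further, $\bar g(x)=\frac1n\sum_{i=1}^n g_i(x)$ is Lipschitz continuous with parameter $L_g$, then $$e^k_{\mathrm{erg}}\le\mathcal{O}(1/k).$$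
   Context: For a convex, closed, proper $h$, $\mathrm{prox}_h(x_0)=\operatorname{argmin}_x\{h(x)+\frac12\|x-x_0\|_2^2\}$. Boldface denotes tuples of $n$ vectors of $\mathbb{R}^d$: $\mathbf{z}=(z_1,\dots,z_n)\in\mathbb{R}^{dn}$. (PPG), with stepsize $\alpha>0$: $x^{k+1/2}=\mathrm{prox}_{\alpha r}\big(\frac1n\sum_{i=1}^n z_i^k\big)$; for all $i=1,\dots,n$, $x_i^{k+1}=\mathrm{prox}_{\alpha g_i}\big(2x^{k+1/2}-z_i^k-\alpha\nabla f_i(x^{k+1/2})\big)$ and $z_i^{k+1}=z_i^k+x_i^{k+1}-x^{k+1/2}$. Write $\mathbf{x}^{k+1}=(x_1^{k+1},\dots,x_n^{k+1})$. The Lagrangian is $\mathcal{L}(x,\mathbf{x},\boldsymbol{\nu})=r(x)+\frac1n\sum_{i=1}^n (f_i(x_i)+g_i(x_i))+\frac1n\sum_{i=1}^n\nu_i^T(x_i-x)$, for $x\in\mathbb{R}^d$, $\mathbf{x},\boldsymbol{\nu}\in\mathbb{R}^{dn}$; a saddle point is minimal in $(x,\mathbf{x})$ and maximal in $\boldsymbol{\nu}$. Notation: $\bar f(x)=\frac1n\sum_i f_i(x)$ and $\bar g(x)=\frac1n\sum_i g_i(x)$ for $x\in\mathbb{R}^d$; $\bar g(\mathbf{x})=\frac1n\sum_i g_i(x_i)$ for $\mathbf{x}\in\mathbb{R}^{dn}$. Ergodic iterates, for $k\ge1$: $x^{k+1/2}_{\mathrm{erg}}=\frac1k\sum_{j=1}^k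 x^{j+1/2}$, $\mathbf{x}^{k+1}_{\mathrm{erg}}=\frac1k\sum_{j=1}^k\mathbf{x}^{j+1}$. Define $$E^k_{\mathrm{erg}}=\big(r(x^{k+1/2}_{\mathrm{erg}})+\bar f(x^{k+1/2}_{\mathrm{erg}})+\bar g(\mathbf{x}^{k+1}_{\mathrm{erg}})\big)-\big(r(x^\star)+\bar f(x^\star)+\bar g(x^\star)\big),$$ $$e^k_{\mathrm{erg}}=\big(r(x^{k+1/2}_{\mathrm{erg}})+\bar f(x^{k+1/2}_{\mathrm{erg}})+\bar g(x^{k+1/2}_{\mathrm{erg}})\big)-\big(r(x^\star)+\bar f(x^\star)+\bar g(x^\star)\big).$$ $\mathcal{O}(\cdot)$ is as $k\to\infty$, with constants independent of $k$. *)

(* Defs.v *)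
(* MathComp-Analysis *)
From HB Require Import structures.
From mathcomp Require Import all_boot all_order all_algebra.
From mathcomp Require Import all_classical all_reals all_analysis.

Set Implicit Arguments.
Unset Strict Implicit.
Unset Printing Implicit Defensive.

Import Order.TTheory GRing.Theory Num.Theory.
Import numFieldNormedType.Exports.

Local Open Scope classical_set_scope.
Local Open Scope ring_scope.

(* The norm `|x| provided by the library on 'rV[R]_d is the max norm, hence the
   Euclidean norm below. *)
Section Euclidean.
Context {R : realType} {d : nat}.

Definition dot (u v : 'rV[R]_d) : R := (u *m v^T) 0 0.

Definition l2norm (u : 'rV[R]_d) : R := Num.sqrt (dot u u).

End Euclidean.

Section ConvexFunctions.
Context {R : realType} {d : nat}.
Implicit Types h : 'rV[R]_d -> \bar R.

(* Excluding -oo makes h a function into R with +oo adjoined. *)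
Definition proper_fun h : Prop :=
  (forall x, h x != -oo%E) /\ (exists x, (h x < +oo)%E).

Definition convex_fun h : Prop := forall (x y : 'rV[R]_d) (t : R), 0 < t < 1 ->
  (h (t *: x + (1 - t) *: y)%R <= t%:E * h x + (1 - t)%:E * h y)%E.

Definition closed_fun h : Prop :=
  closed [set p : 'rV[R]_d * R | (h p.1 <= p.2%:E)%E].

Definition ccp h : Prop := [/\ convex_fun h, closed_fun h & proper_fun h].

(* [fine] sends infinite values to 0, so finiteness is required separately. *)
Definition differentiable_fun h : Prop :=
  forall x, h x \is a fin_num /\ differentiable (fine \o h) x.

Definition grad h (x : 'rV[R]_d) : 'rV[R]_d :=
  \row_(j < d) 'D_(delta_mx 0 j) (fine \o h) x.

Definition lipschitz_grad (L : R) h : Prop :=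
  forall x y, l2norm (grad h x - grad h y) <= L * l2norm (x - y).

Definition lipschitz_fun (L : R) h : Prop :=
  (forall x, h x \is a fin_num) /\
  (forall x y, (`|h x - h y| <= (L * l2norm (x - y)%R)%:E)%E).

Definition argmin h : set 'rV[R]_d := [set p | forall x, (h p <= h x)%E].

(* p = prox_h(x0), as a relation; for h convex, closed and proper the set of
   minimizers is a singleton. *)
Definition is_prox h (x0 p : 'rV[R]_d) : Prop :=
  argmin (fun x => h x + (2^-1 * l2norm (x - x0)%R ^+ 2)%:E)%E p.

End ConvexFunctions.

Section Problem.
Context {R : realType} {d n : nat}.
Implicit Types (r : 'rV[R]_d -> \bar R) (f g : 'I_n -> 'rV[R]_d -> \bar R).

Definition mean (F : 'I_n -> \bar R) : \bar R :=
  ((n%:R^-1)%:E * \sum_(i < n) F i)%E.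

Definition bar f (x : 'rV[R]_d) : \bar R := mean (fun i => f i x).

Definition bar_tuple g (x : 'I_n -> 'rV[R]_d) : \bar R :=
  mean (fun i => g i (x i)).

Definition objective r f g (x : 'rV[R]_d) : \bar R :=
  (r x + mean (fun i => f i x + g i x))%E.

Definition lagrangian r f g (x : 'rV[R]_d) (xs nu : 'I_n -> 'rV[R]_d) : \bar R :=
  (r x + mean (fun i => f i (xs i) + g i (xs i))
       + mean (fun i => (dot (nu i) (xs i - x)%R)%:E))%E.

Definition saddle_point r f g x xs nu : Prop :=
  (forall nu', (lagrangian r f g x xs nu' <= lagrangian r f g x xs nu)%E) /\
  (forall x' xs', (lagrangian r f g x xs nu <= lagrangian r f g x' xs' nu)%E).

(* [xh k] is x^{k+1/2}; [xs k i] is x_i^k, which the method determines only for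
   k >= 1; the starting point [z 0] is unconstrained. *)
Definition PPG r f g (alpha : R) (z : nat -> 'I_n -> 'rV[R]_d)
    (xh : nat -> 'rV[R]_d) (xs : nat -> 'I_n -> 'rV[R]_d) : Prop :=
  forall k : nat,
  [/\ is_prox (fun x => alpha%:E * r x)%E (n%:R^-1 *: \sum_(i < n) z k i) (xh k),
      forall i, is_prox (fun x => alpha%:E * g i x)%E
        (2 *: xh k - z k i - alpha *: grad (f i) (xh k)) (xs k.+1 i)
    & forall i, z k.+1 i = z k i + xs k.+1 i - xh k].

Definition xh_erg (xh : nat -> 'rV[R]_d) (k : nat) : 'rV[R]_d :=
  k%:R^-1 *: \sum_(1 <= j < k.+1) xh j.

(* [xs_erg xs k] is the ergodic average carrying the superscript k+1. *)
Definition xs_erg (xs : nat -> 'I_n -> 'rV[R]_d) (k : nat) (i : 'I_n) :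
    'rV[R]_d :=
  k%:R^-1 *: \sum_(1 <= j < k.+1) xs j.+1 i.

Definition E_erg r f g xh xs (xstar : 'rV[R]_d) (k : nat) : \bar R :=
  ((r (xh_erg xh k) + bar f (xh_erg xh k) + bar_tuple g (xs_erg xs k))
   - (r xstar + bar f xstar + bar g xstar))%E.

Definition e_erg r f g xh (xstar : 'rV[R]_d) (k : nat) : \bar R :=
  ((r (xh_erg xh k) + bar f (xh_erg xh k) + bar g (xh_erg xh k))
   - (r xstar + bar f xstar + bar g xstar))%E.

End Problem.

(* a_k <= O(b_k) as k -> oo; one-sided: a itself may be very negative. *)
Definition le_bigO {R : realType} (a : nat -> \bar R) (b : nat -> R) : Prop :=
  exists2 u : nat -> R^o, u =O_\oo (b : nat -> R^o) &
    \forall k \near \oo, (a k <= (u k)%:E)%E.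

(* Main.v *)
Require Import Defs.
From mathcomp Require Import all_boot all_order all_algebra.
From mathcomp Require Import ring lra.
From mathcomp Require Import all_classical all_reals all_analysis.

Set Implicit Arguments.
Unset Strict Implicit.
Unset Printing Implicit Defensive.

Import Order.TTheory GRing.Theory Num.Theory.
Import numFieldNormedType.Exports.

Local Open Scope classical_set_scope.
Local Open Scope ring_scope.

(** The iteration is a splitting method, and the proof exhibits quantities that
    decrease along it.

    A saddle point of the Lagrangian may be moved to the given solution
    [xstar] without changing its multipliers [nu] ([saddle_at_solution]), which
    yields subgradients of [r] and of the [g i] at [xstar]
    ([dual_certificate]): the average of the [nu i] for [r], and
    [- (grad (f i) xstar + nu i)] for [g i].

    The two proximal steps say that [r] at [xh k] and [g i] at [xs k.+1 i] have
    explicit subgradients. Write [G i] for the difference of the gradients of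
    [f i] at [xh k] and at [xstar], and [w i] for the step
    [z k.+1 i - z k i], which equals [xs k.+1 i - xh k].
    Monotonicity of the subgradients and cocoercivity of the gradients
    ([grad_cocoercive]) show that the mean square distance of [z k] to
    [xstar + alpha nu] decreases by at least a positive multiple of the mean of
    the squared norms of the [G i], as soon as [alpha < 2 / L] ([fejer]). Hence
    these squared norms are summable in [k] and the iterates are bounded.

    The convexity inequalities at the solution bound the primal gap of one
    iteration by a telescoping term plus [2^-1 * alpha ^+ 2] times the mean of
    the squared norms of the [G i]. The smoothness of the [f i] could cancel
    that extra term only for [alpha <= 1 / L], but by the preceding estimate it
    is summable for all [alpha < 2 / L]: adding the right multiple of the mean
    square distance to the telescoping potential absorbs it ([gap_le]). Summing
    and applying Jensen's inequality give the upper bound of order 1/k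
    ([gap_erg_upper]).

    From below, the subgradients at [xstar] bound the ergodic gap by an average
    of inner products of fixed vectors with [xs_erg xs k i - xh_erg xh k]. The
    steps telescope, so that this difference is [k%:R^-1] times
    [z k.+1 i - z 1 i] ([erg_drift]), where the second factor is bounded
    ([drift_bound]).

    For the second claim, [g i] must be evaluated at [xh_erg xh k] instead of
    [xs_erg xs k i], points that are O(1/k) apart. Lipschitz continuity of the
    average of the [g i] alone does not control this change, since the points
    [xs_erg xs k i] differ; but it forces every [g i] to be Lipschitz, because
    the other summands have affine minorants ([summand_lipschitz]). *)

(** * The Euclidean inner product *)

Section InnerProduct.
Context {R : realType} {d : nat}.
Implicit Types (u v w x y : 'rV[R]_d) (c : R).

Lemma dotE u v : dot u v = \sum_j u 0 j * v 0 j.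
Proof. by rewrite /dot mxE; apply: eq_bigr => j _; rewrite mxE. Qed.

Lemma dotC u v : dot u v = dot v u.
Proof. by rewrite !dotE; apply: eq_bigr => j _; rewrite mulrC. Qed.

Lemma dotDl u v w : dot (u + v) w = dot u w + dot v w.
Proof. by rewrite /dot mulmxDl mxE. Qed.

Lemma dotNl u w : dot (- u) w = - dot u w.
Proof. by rewrite /dot mulNmx mxE. Qed.

Lemma dotZl c u w : dot (c *: u) w = c * dot u w.
Proof. by rewrite /dot -scalemxAl mxE. Qed.

Lemma dotDr u v w : dot w (u + v) = dot w u + dot w v.
Proof. by rewrite dotC dotDl !(dotC w). Qed.

Lemma dotNr u w : dot w (- u) = - dot w u.
Proof. by rewrite dotC dotNl dotC. Qed.

Lemma dotZr c u w : dot w (c *: u) = c * dot w u.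
Proof. by rewrite dotC dotZl dotC. Qed.

Lemma dot0l w : dot 0 w = 0.
Proof. by rewrite /dot mul0mx mxE. Qed.

Lemma dot0r w : dot w 0 = 0.
Proof. by rewrite dotC dot0l. Qed.

Lemma dot_suml (I : finType) (F : I -> 'rV[R]_d) w :
  dot (\sum_i F i) w = \sum_i dot (F i) w.
Proof. by rewrite /dot mulmx_suml summxE. Qed.

Definition dotL := (dotDl, dotDr, dotNl, dotNr, dotZl, dotZr).

Lemma dot_ge0 u : 0 <= dot u u.
Proof. by rewrite dotE sumr_ge0// => j _; rewrite -expr2 sqr_ge0. Qed.

Lemma dot_eq0 u : dot u u = 0 -> u = 0.
Proof.
rewrite dotE => /eqP; rewrite psumr_eq0; last first.
  by move=> j _; rewrite -expr2 sqr_ge0.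
move=> /allP u0; apply/rowP => j; rewrite mxE.
by have /= := u0 j (mem_index_enum j); rewrite -expr2 sqrf_eq0 => /eqP.
Qed.

Lemma l2norm_ge0 u : 0 <= l2norm u. Proof. exact: sqrtr_ge0. Qed.

Lemma l2norm_sqr u : l2norm u ^+ 2 = dot u u.
Proof. by rewrite /l2norm sqr_sqrtr// dot_ge0. Qed.

Lemma l2normZ c u : 0 <= c -> l2norm (c *: u) = c * l2norm u.
Proof.
move=> c0; rewrite /l2norm dotZl dotZr mulrA -expr2 sqrtrM ?sqr_ge0//.
by rewrite sqrtr_sqr ger0_norm.
Qed.

(** The discriminant argument, in the form of the nonnegativity of the squared
    norm of [dot v v *: u - dot u v *: v]. *)
Lemma normr_dot_le u v : `|dot u v| <= l2norm u * l2norm v.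
Proof.
have [/eqP|v0] := boolP (dot v v == 0).
  move=> /dot_eq0 ->; rewrite dot0r normr0 mulr_ge0 ?l2norm_ge0//.
have vgt0 : 0 < dot v v by rewrite lt_def v0 dot_ge0.
rewrite -ler_sqr ?nnegrE ?normr_ge0 ?mulr_ge0 ?l2norm_ge0//.
rewrite exprMn !l2norm_sqr real_normK ?num_real//.
have := dot_ge0 (dot v v *: u - dot u v *: v).
rewrite !dotL (dotC v u) => H.
rewrite -subr_ge0 -(pmulr_rge0 _ vgt0).
by apply: le_trans H _; rewrite le_eqVlt; apply/orP; left; apply/eqP; ring.
Qed.

Lemma young_dot u v : dot u v <= 2^-1 * dot u u + 2^-1 * dot v v.
Proof. by have := dot_ge0 (u - v); rewrite !dotL (dotC v u); lra. Qed.

End InnerProduct.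

(** * The descent lemma *)

Section Descent.
Context {R : realType} {d : nat}.
Implicit Types (F : 'rV[R]_d -> R) (x v : 'rV[R]_d).

(** The mean value theorem applied to [phi] itself would lose the factor one
    half; applied to the difference of [phi] and its quadratic model [psi] it
    gives the sharp constant. *)
Lemma line_taylor_le (phi dphi : R -> R) (M : R) :
  (forall t : R, is_derive t 1 phi (dphi t)) ->
  (forall t, 0 < t < 1 -> dphi t <= dphi 0 + M * t) ->
  phi 1 <= phi 0 + dphi 0 + 2^-1 * M.
Proof.
move=> phiD dphiM.
pose psi t := phi t - (dphi 0 * t + 2^-1 * M * t ^+ 2).
have psiD (t : R) : is_derive t 1 psi (dphi t - (dphi 0 + M * t)).
  rewrite /psi; apply: is_derive_eq.
  by rewrite /= /GRing.scale /=; lra.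
have psiC : {within `[0, 1], continuous psi}.
  by apply: derivable_within_continuous => t _; exact: ex_derive.
have [c /[!in_itv]/= c01] := @MVT R psi _ 0 1 ltr01 (fun t _ => psiD t) psiC.
rewrite subr0 mulr1 /psi expr0n/= expr1n.
by have := dphiM c c01; lra.
Qed.

(** Differentiability turns the derivative in the direction [v] into the
    combination of partial derivatives from which [grad] is built. *)
Lemma is_derive_line F x v t : differentiable F (x + t *: v) ->
  is_derive (t : R^o) (1 : R^o) (fun s : R^o => F (x + s *: v) : R^o)
    (\sum_j v 0 j * 'D_('e_j) F (x + t *: v)).
Proof.
move=> dF.
have -> : \sum_j v 0 j * 'D_('e_j) F (x + t *: v) = 'D_v F (x + t *: v).
  rewrite (deriveE v dF) [X in 'd _ _ X](row_sum_delta v) linear_sum/=.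
  by apply: eq_bigr => j _; rewrite linearZ/= deriveE.
have quotE : (fun h : R => h^-1 *: (((fun s : R^o => F (x + s *: v) : R^o)
      \o shift (t : R^o)) (h *: (1 : R^o)) - F (x + t *: v))) =
    (fun h : R => h^-1 *:
      ((F \o shift (x + t *: v)) (h *: v) - F (x + t *: v))).
  apply/funext => h /=; congr (_ *: (F _ - _)).
  by rewrite [h *: (1 : R^o)]mulr1 scalerDl addrCA.
apply: DeriveDef; first by rewrite /derivable quotE; exact: diff_derivable.
by rewrite /derive quotE.
Qed.

Lemma descent F (gradF : 'rV[R]_d -> 'rV[R]_d) (L : R) :
  (forall x, differentiable F x) ->
  (forall x, gradF x = \row_j 'D_('e_j) F x) ->
  (forall x y, l2norm (gradF x - gradF y) <= L * l2norm (x - y)) ->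
  forall x y, `|F y - F x - dot (gradF x) (y - x)| <=
    2^-1 * L * dot (y - x) (y - x).
Proof.
move=> dF gradE lipF x y; set v := y - x.
pose D (t : R) := dot (gradF (x + t *: v)) v.
have DE (t : R) : \sum_j v 0 j * 'D_('e_j) F (x + t *: v) = D t.
  rewrite /D dotC dotE; apply: eq_bigr => j _; congr (_ * _).
  by rewrite gradE mxE.
have DB (t : R) : 0 < t < 1 -> `|D t - D 0| <= L * dot v v * t.
  move=> /andP[t0 _]; rewrite /D -dotNl -dotDl scale0r addr0.
  apply: le_trans (normr_dot_le _ _) _.
  apply: le_trans (ler_wpM2r (l2norm_ge0 _) (lipF _ _)) _.
  rewrite [x + _]addrC addrK l2normZ ?(ltW t0)// -l2norm_sqr.
  by rewrite le_eqVlt; apply/orP; left; apply/eqP; ring.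
have phiD (t : R) : is_derive t (1 : R) (fun s : R => F (x + s *: v)) (D t).
  by rewrite -DE; apply: is_derive_line.
have phiND (t : R) :
    is_derive t (1 : R) (fun s : R => - F (x + s *: v)) (- D t).
  exact: is_deriveN.
have hi : F (x + 1 *: v) <= F (x + 0 *: v) + D 0 + 2^-1 * (L * dot v v).
  by apply: (line_taylor_le phiD) => t /DB; rewrite ler_norml => /andP[_]; lra.
have lo : - F (x + 1 *: v) <=
    - F (x + 0 *: v) - D 0 + 2^-1 * (L * dot v v).
  by apply: (line_taylor_le phiND) => t /DB; rewrite ler_norml => /andP[]; lra.
move: hi lo; rewrite /D scale1r scale0r addr0 /v [x + _]addrC subrK -/v.
by move=> hi lo; rewrite ler_norml; apply/andP; split; lra.
Qed.

End Descent.

(** * Subgradients and proximal steps *)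

Section Subgradient.
Context {R : realType} {d : nat}.
Implicit Types (h : 'rV[R]_d -> \bar R) (x y s : 'rV[R]_d).

Definition subgradient h x s : Prop :=
  h x \is a fin_num /\ forall y, (h x + (dot s (y - x))%:E <= h y)%E.

Lemma subgradient_fine h x s y : subgradient h x s -> h y \is a fin_num ->
  fine (h x) + dot s (y - x) <= fine (h y).
Proof.
move=> [hx /(_ y)] le_hy hy; move: le_hy.
by rewrite -(fineK hx) -(fineK hy) -EFinD lee_fin.
Qed.

Lemma subgradient_monotone h x y s t : subgradient h x s ->
  subgradient h y t -> 0 <= dot (s - t) (x - y).
Proof.
move=> hs ht; have := subgradient_fine hs ht.1.
have := subgradient_fine ht hs.1.
by rewrite !dotL; lra.
Qed.

Lemma le_of_le_add_small (a b c : R) :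
  (forall t, 0 < t < 1 -> a <= b + t * c) -> a <= b.
Proof.
move=> H; rewrite leNgt; apply/negP => ba.
(* The witness [t] is below [1] and makes [t * `|c|] smaller than [a - b]. *)
have D0 : 0 < a - b + `|c| + 1 by have := normr_ge0 c; lra.
have := H ((a - b) / (a - b + `|c| + 1)).
rewrite divr_gt0 ?subr_gt0//= ltr_pdivrMr// mul1r.
have /[swap]/[apply] : a - b < a - b + `|c| + 1 by have := normr_ge0 c; lra.
rewrite mulrAC -lerBlDl ler_pdivlMr//.
have : (a - b) * c <= (a - b) * `|c|.
  by rewrite ler_wpM2l ?ler_norm// subr_ge0 ltW.
have : 0 < (a - b) * (a - b) by rewrite mulr_gt0// subr_gt0.
by nra.
Qed.

(** Moving from the minimizer [p] towards [y] by a fraction [t] changes [h] by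
    at most [t] times its increment, by convexity, and [phi] by at most [t]
    times its slope plus a term quadratic in [t]; after division by [t] the
    latter disappears as [t] tends to [0]. An upper quadratic model of [phi] is
    all that is assumed of it, so that the lemma applies to the squared distance
    of a proximal step, to a smooth convex function and to the opposite of
    one. *)
Lemma minimizer_subgradient h (phi : 'rV[R]_d -> R) p s (c : R) :
  convex_fun h -> (forall x, h x != -oo%E) -> h p \is a fin_num ->
  (forall y, (h p + (phi p)%:E <= h y + (phi y)%:E)%E) ->
  (forall y, phi y <= phi p + dot s (y - p) + c * dot (y - p) (y - p)) ->
  subgradient h p (- s).
Proof.
move=> cvx hNy hp pmin phi_le; split=> // y.
have [yfin|] := boolP (h y \is a fin_num); last first.
  rewrite fin_numE hNy/= => /negPn/eqP ->; exact: leey.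
rewrite -(fineK hp) -(fineK yfin) -EFinD lee_fin.
apply: (@le_of_le_add_small _ _ (c * dot (y - p) (y - p))) => t t01.
have H1 := pmin (t *: y + (1 - t) *: p); have H2 := cvx y p t t01.
rewrite -(fineK hp) -(fineK yfin) -!EFinM -!EFinD in H1 H2.
case E : (h (t *: y + (1 - t) *: p)) H1 H2 => [a| |]; last 2 first.
- by rewrite leye_eq.
- by have := hNy (t *: y + (1 - t) *: p); rewrite E.
rewrite -EFinD !lee_fin => H1 H2.
have := phi_le (t *: y + (1 - t) *: p).
have -> : t *: y + (1 - t) *: p - p = t *: (y - p).
  by rewrite scalerBl scale1r scalerBr addrAC addrA subrK.
rewrite !dotL.
move/andP: t01 => [t0 _] H3; rewrite -(ler_pM2l t0); nra.
Qed.

Lemma prox_subgradient h (alpha : R) x0 p : 0 < alpha -> ccp h ->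
  is_prox (fun x => alpha%:E * h x)%E x0 p ->
  subgradient h p (alpha^-1 *: (x0 - p)).
Proof.
move=> a0 [cvx _ [hNy [w hw]]] pmin.
have an0 : alpha != 0 by rewrite gt_eqF.
have hp : h p \is a fin_num.
  have wfin : h w \is a fin_num by rewrite fin_numE hNy -ltey.
  rewrite fin_numE hNy/=; apply/negP => /eqP hpy; have := pmin w.
  by rewrite hpy -(fineK wfin) gt0_muley ?lte_fin// addye.
have -> : alpha^-1 *: (x0 - p) = - (alpha^-1 *: (p - x0)).
  by rewrite -scalerN opprB.
pose phi x := alpha^-1 * (2^-1 * dot (x - x0) (x - x0)).
apply: (@minimizer_subgradient h phi p _ (alpha^-1 * 2^-1)) => //.
- move=> y; have := pmin y; rewrite !l2norm_sqr /phi.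
  have [yfin|] := boolP (h y \is a fin_num); last first.
    rewrite fin_numE hNy/= => /negPn/eqP -> _; rewrite addye//; exact: leey.
  rewrite -(fineK hp) -(fineK yfin) -!EFinM -!EFinD !lee_fin => H.
  by rewrite -(ler_pM2l a0) !mulrDr !(mulVKf an0).
- move=> y; rewrite /phi.
  have -> : y - x0 = (p - x0) + (y - p) by rewrite [RHS]addrC addrA subrK.
  move: (p - x0) (y - p) => u v; rewrite !dotL (dotC v u).
  by rewrite le_eqVlt; apply/orP; left; apply/eqP; field.
Qed.

End Subgradient.

(** * Convex functions with Lipschitz gradient *)

Section Smooth.
Context {R : realType} {d : nat}.
Variables (f : 'rV[R]_d -> \bar R) (L : R).
Hypotheses (cvxf : ccp f) (df : differentiable_fun f).
Hypothesis lipf : lipschitz_grad L f.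

Lemma smooth_bound x y :
  `|fine (f y) - fine (f x) - dot (grad f x) (y - x)| <=
  2^-1 * L * dot (y - x) (y - x).
Proof.
have df' z : differentiable (fine \o f) z by have [] := df z.
exact: (descent df' (fun=> erefl) lipf).
Qed.

(** Every [x] minimizes the zero function [f - f], whose second term has an
    upper quadratic model with slope [- grad f x] by the descent lemma. *)
Lemma grad_subgradient x : subgradient f x (grad f x).
Proof.
have [cvx _ [fNy _]] := cvxf.
have ff z : f z \is a fin_num by have [] := df z.
rewrite -[grad f x]opprK.
apply: (@minimizer_subgradient _ _ f (fun z => - fine (f z)) _ _
  (2^-1 * L)) => //.
- by move=> y; rewrite -(fineK (ff x)) -(fineK (ff y)) -!EFinD !subrr.
- move=> y; have := smooth_bound x y; rewrite ler_norml => /andP[+ _].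
  by rewrite dotNl; lra.
Qed.

(** The tangent inequality at [x] is not applied at [y] but at the point [w]
    reached from [y] by a gradient step for [f] minus its tangent at [x]; the
    descent lemma at [y] accounts for the decrease between [y] and [w]. *)
Lemma baillon_haddad x y : 0 < L ->
  fine (f x) + dot (grad f x) (y - x) +
    (2 * L)^-1 * dot (grad f y - grad f x) (grad f y - grad f x) <= fine (f y).
Proof.
move=> L0; set G := grad f y - grad f x.
have ff z : f z \is a fin_num by have [] := df z.
pose w := y - L^-1 *: G.
have lo := subgradient_fine (grad_subgradient x) (ff w).
have := smooth_bound y w; rewrite ler_norml => /andP[_ hi].
have wy : w - y = - (L^-1 *: G) by rewrite /w addrC addrA addNr add0r.
have wx : w - x = (y - x) - L^-1 *: G by rewrite /w addrAC.
have gG : dot (grad f y) G - dot (grad f x) G = dot G G.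
  by rewrite -dotNl -dotDl.
rewrite wx in lo; rewrite wy in hi; move: lo hi.
rewrite (dotDr _ _ (grad f x)) !(dotNl, dotNr, dotZl, dotZr) => lo hi.
have E : (2 * L)^-1 * dot G G = L^-1 * dot G G -
    2^-1 * L * - - (L^-1 * (L^-1 * dot G G)).
  by field; rewrite gt_eqF.
have : L^-1 * dot G G = L^-1 * dot (grad f y) G - L^-1 * dot (grad f x) G.
  by rewrite -gG mulrBr.
by rewrite E; lra.
Qed.

Lemma grad_cocoercive x y : 0 < L ->
  L^-1 * dot (grad f x - grad f y) (grad f x - grad f y) <=
  dot (grad f x - grad f y) (x - y).
Proof.
move=> L0; have := baillon_haddad x y L0; have := baillon_haddad y x L0.
have -> : L^-1 = 2 * (2 * L)^-1 by field; rewrite gt_eqF.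
rewrite !dotL (dotC (grad f y) (grad f x)); lra.
Qed.

End Smooth.

(** * Averages over the blocks *)

Section Average.
Context {R : realType} {n : nat}.
Implicit Types (F G : 'I_n -> R) (a c : R).

Definition avg F : R := n%:R^-1 * \sum_i F i.

Lemma avgD F G : avg (fun i => F i + G i) = avg F + avg G.
Proof. by rewrite /avg big_split/= mulrDr. Qed.

Lemma avgN F : avg (fun i => - F i) = - avg F.
Proof. by rewrite /avg sumrN mulrN. Qed.

Lemma avgB F G : avg (fun i => F i - G i) = avg F - avg G.
Proof. by rewrite avgD avgN. Qed.

Lemma avgZ c F : avg (fun i => c * F i) = c * avg F.
Proof. by rewrite /avg -mulr_sumr mulrCA. Qed.

Lemma ler_avg F G : (forall i, F i <= G i) -> avg F <= avg G.
Proof. by move=> FG; rewrite ler_wpM2l ?invr_ge0// ler_sum. Qed.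

Lemma eq_avg F G : (forall i, F i = G i) -> avg F = avg G.
Proof. by move=> FG; congr (_ * _); apply: eq_bigr => i _. Qed.

Lemma avg_ge0 F : (forall i, 0 <= F i) -> 0 <= avg F.
Proof. by move=> F0; rewrite mulr_ge0 ?invr_ge0// sumr_ge0. Qed.

Lemma avg_cst c : (0 < n)%N -> avg (fun=> c) = c.
Proof.
move=> n0; rewrite /avg sumr_const card_ord -[c *+ n]mulr_natl mulKf//.
by rewrite pnatr_eq0 -lt0n.
Qed.

Lemma avg_sumr (s : seq nat) (F : nat -> 'I_n -> R) :
  avg (fun i => \sum_(j <- s) F j i) = \sum_(j <- s) avg (F j).
Proof. by rewrite /avg exchange_big mulr_sumr. Qed.

Lemma dot_avgl d (a : 'I_n -> 'rV[R]_d) w :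
  dot (n%:R^-1 *: \sum_i a i) w = avg (fun i => dot (a i) w).
Proof. by rewrite dotZl dot_suml. Qed.

Lemma mean_fin (F : 'I_n -> \bar R) : (forall i, F i \is a fin_num) ->
  mean F = (avg (fun i => fine (F i)))%:E.
Proof.
move=> Ff; rewrite /mean EFinM -sumEFin; congr (_ * _)%E.
by apply: eq_bigr => i _; rewrite fineK.
Qed.

Lemma mean_eqy (F : 'I_n -> \bar R) i : (forall j, F j != -oo%E) ->
  F i = +oo%E -> mean F = +oo%E.
Proof.
move=> FNy Fi; rewrite /mean.
have n0 : (0 < n)%N by apply: leq_trans (ltn_ord i).
suff -> : (\sum_(j < n) F j = +oo)%E.
  by rewrite gt0_muley// lte_fin invr_gt0 ltr0n.
by apply/esum_eqyP => //; exists i; split; rewrite ?mem_index_enum.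
Qed.

Lemma mean_fin_num (F : 'I_n -> \bar R) : (forall j, F j != -oo%E) ->
  mean F \is a fin_num -> forall i, F i \is a fin_num.
Proof.
move=> FNy mF i; rewrite fin_numE FNy/=; apply/eqP => Fi.
by move: mF; rewrite (mean_eqy FNy Fi).
Qed.

End Average.

(** * Jensen's inequality for ergodic averages *)

Section Jensen.
Context {R : realType} {d : nat}.

Lemma jensen_erg (h : 'rV[R]_d -> \bar R) (y : nat -> 'rV[R]_d) (k : nat) :
  convex_fun h -> (forall x, h x != -oo%E) ->
  (forall j, h (y j) \is a fin_num) -> (0 < k)%N ->
  h (k%:R^-1 *: \sum_(1 <= j < k.+1) y j) \is a fin_num /\
  fine (h (k%:R^-1 *: \sum_(1 <= j < k.+1) y j)) <=
    k%:R^-1 * \sum_(1 <= j < k.+1) fine (h (y j)).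
Proof.
move=> cvx hNy hy; case: k => // k _; elim: k => [|k [IHf IH]].
  by rewrite !big_nat1 invr1 scale1r mul1r.
set a := _ *: _ in IHf IH.
set t : R := k.+2%:R^-1.
have t01 : 0 < t < 1 by rewrite invr_gt0 ltr0n invf_lt1 ?ltr1n ?ltr0n.
have t1 : t * k.+1%:R = 1 - t.
  apply: (@mulfI _ k.+2%:R); first by rewrite pnatr_eq0.
  by rewrite mulrBr mulrA mulfV ?pnatr_eq0// mul1r mulr1 -[in RHS]natr1 addrK.
have t1' : t = (1 - t) * k.+1%:R^-1 by rewrite -t1 mulfK ?pnatr_eq0.
have -> : t *: \sum_(1 <= j < k.+3) y j = t *: y k.+2 + (1 - t) *: a.
  by rewrite big_nat_recr//= scalerDr addrC /a scalerA -t1'.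
have := cvx (y k.+2) a t t01.
rewrite -(fineK IHf) -(fineK (hy _)) -!EFinM -EFinD.
case E : (h (t *: y k.+2 + (1 - t) *: a)) => [b| |]; last 2 first.
- by rewrite leye_eq.
- by have := hNy (t *: y k.+2 + (1 - t) *: a); rewrite E.
rewrite lee_fin => hb; split=> //=; apply: le_trans hb _.
rewrite big_nat_recr//= mulrDr addrC lerD2r {2}t1' -mulrA ler_wpM2l//.
by move/andP: t01 => [_ ?]; rewrite subr_ge0 ltW.
Qed.

End Jensen.

(** * Inner product inequalities for one block *)

Section StepInequalities.
Context {R : realType} {d : nat}.
Implicit Types (u v w : 'rV[R]_d) (alpha L : R).

(** With [delta] the offset of [z k i] from its fixed point, [xi] that of [xh k]
    from the solution and [w] the step, the left-hand side is what monotonicity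
    of the subgradients makes nonnegative. It equals
    [- dot (delta + w) w - alpha * dot G xi - alpha * dot G w]; cocoercivity
    bounds the second term, and completing the square in [w + alpha *: G] the
    third. *)
Lemma fejer_term alpha L delta xi w (G : 'rV[R]_d) : 0 < alpha ->
  L^-1 * dot G G <= dot G xi ->
  dot (delta - xi) xi + dot (xi - delta - w - alpha *: G) (xi + w) <=
  2^-1 * dot delta delta - 2^-1 * dot (delta + w) (delta + w)
    - (alpha / L - 2^-1 * alpha ^+ 2) * dot G G.
Proof.
move=> a0 coco.
have := ler_wpM2l (ltW a0) coco.
have := dot_ge0 (w + alpha *: G).
rewrite !dotL ?(dotC w delta) ?(dotC xi delta) ?(dotC w G) ?(dotC w xi).
by nra.
Qed.

(** The analogue for function values, with [e] the offset of [z k i] from the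
    solution, [D] the gradient at [xh k] and [D0] the gradient at the solution.
    Splitting [D] into [D0] and [D - D0] leaves a part linear in [w], which
    telescopes, and one that completing the square in [w + alpha *: (D - D0)]
    turns into the last term. *)
Lemma gap_term alpha e xi w (D D0 : 'rV[R]_d) :
  dot (e - xi) xi +
    (alpha * dot D xi + dot (xi - e - w - alpha *: D) (xi + w)) <=
  2^-1 * dot e e - 2^-1 * dot (e + w) (e + w) - alpha * dot D0 w
    + 2^-1 * alpha ^+ 2 * dot (D - D0) (D - D0).
Proof.
have := dot_ge0 (w + alpha *: (D - D0)).
rewrite !dotL ?(dotC w e) ?(dotC xi e) ?(dotC w D) ?(dotC w D0).
rewrite ?(dotC w xi) ?(dotC D0 D).
by nra.
Qed.

End StepInequalities.

(** * Summands of a Lipschitz average of convex functions *)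

Section LipschitzSummands.
Context {R : realType} {d n : nat}.

(** The increment of a convex function over [q - p] is at most [t] times its
    increment over [t^-1 *: (q - p)]. The latter is the increment of the total,
    which is Lipschitz, minus the increments of the other summands, which are
    bounded below by their affine minorants at [a] up to constants [slack j].
    As [t] tends to [0] the constants disappear and only the slopes remain. *)
Lemma summand_lipschitz (g : 'I_n -> 'rV[R]_d -> \bar R) (Lg : R) a s :
  (0 < n)%N -> (forall i, convex_fun (g i)) ->
  (forall i x, g i x \is a fin_num) ->
  (forall i, subgradient (g i) a (s i)) -> lipschitz_fun Lg (bar g) ->
  forall i p q, fine (g i q) - fine (g i p) <=
    (n%:R * Lg + \sum_(j | j != i) l2norm (s j)) * l2norm (q - p).
Proof.
move=> n0 cvx gfin gs [_ lipg] i p q; set v := q - p.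
have nN0 : n%:R != 0 :> R by rewrite pnatr_eq0 -lt0n.
pose slack j := fine (g j a) + dot (s j) (p - a) - fine (g j p).
apply: (@le_of_le_add_small _ _ _ (- \sum_(j | j != i) slack j)) => t t01.
have /andP[t0 _] := t01.
pose y := p + t^-1 *: v.
have qE : q = t *: y + (1 - t) *: p.
  rewrite /y scalerDr scalerA mulfV ?gt_eqF// scale1r addrAC -scalerDl.
  by rewrite addrC subrKC scale1r /v subrK.
have hq : fine (g i q) - fine (g i p) <= t * (fine (g i y) - fine (g i p)).
  have := cvx i y p t t01; rewrite -qE.
  rewrite -(fineK (gfin i q)) -(fineK (gfin i y)) -(fineK (gfin i p)).
  by rewrite -!EFinM -EFinD lee_fin; lra.
have htot : \sum_j (fine (g j y) - fine (g j p)) <=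
    n%:R * (Lg * (t^-1 * l2norm v)).
  have := lipg y p; rewrite /bar !mean_fin// -EFinB lee_fin.
  have -> : y - p = t^-1 *: v by rewrite /y addrC addKr.
  rewrite l2normZ ?invr_ge0 ?(ltW t0)// => /(le_trans (ler_norm _)).
  rewrite -avgB /avg => H.
  by rewrite -(ler_pM2l (_ : 0 < n%:R^-1)) ?invr_gt0 ?ltr0n// mulKf.
have hmin j : slack j + t^-1 * dot (s j) v <= fine (g j y) - fine (g j p).
  have := subgradient_fine (gs j) (gfin j y).
  have -> : y - a = (p - a) + t^-1 *: v by rewrite /y addrAC.
  by rewrite dotDr dotZr /slack; lra.
have hrest : \sum_(j | j != i) slack j - t^-1 * \sum_(j | j != i)
    (l2norm (s j) * l2norm v) <=
    \sum_(j | j != i) (fine (g j y) - fine (g j p)).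
  rewrite mulr_sumr -sumrB ler_sum// => j _; apply: le_trans (hmin j).
  rewrite lerD2l -mulrN ler_wpM2l ?invr_ge0 ?(ltW t0)//.
  by have := normr_dot_le (s j) v; rewrite ler_norml => /andP[].
rewrite (bigD1 i)//= in htot.
apply: le_trans hq _.
rewrite mulrDl mulr_suml.
move: htot hrest; set S := \sum_(j | _) slack j; set N := \sum_(j | _) (_ * _).
set T := \sum_(j | _) _ => htot hrest.
have : fine (g i y) - fine (g i p) <=
  n%:R * (Lg * (t^-1 * l2norm v)) - S + t^-1 * N by lra.
move/(ler_wpM2l (ltW t0))/le_trans; apply.
rewrite le_eqVlt; apply/orP; left; apply/eqP; field; exact: lt0r_neq0.
Qed.

End LipschitzSummands.

(** * Multipliers at a solution *)

Section SaddlePoint.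
Context {R : realType} {d n : nat}.
Variables (r : 'rV[R]_d -> \bar R) (f g : 'I_n -> 'rV[R]_d -> \bar R) (L : R).
Hypotheses (n0 : (0 < n)%N) (ccpr : ccp r) (ccpg : forall i, ccp (g i)).
Hypothesis ccpf : forall i, ccp (f i).
Hypothesis df : forall i, differentiable_fun (f i).
Hypothesis lipf : forall i, lipschitz_grad L (f i).

Let rNy x : r x != -oo%E. Proof. by case: ccpr => _ _ []. Qed.
Let gNy i x : g i x != -oo%E. Proof. by case: (ccpg i) => _ _ []. Qed.
Let ffin i x : f i x \is a fin_num. Proof. by case: (df i x). Qed.

Let fgNy i x y : (f i x + g i y)%E != -oo%E.
Proof.
rewrite adde_eq_ninfty negb_or gNy andbT.
by have := ffin i x; rewrite fin_numE => /andP[].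
Qed.

Lemma mean_sumNy x : mean (fun i => f i (x i) + g i (x i))%E != -oo%E.
Proof.
have [/forallP h|] := boolP [forall i, (f i (x i) + g i (x i))%E \is a fin_num].
  by rewrite mean_fin.
rewrite negb_forall => /existsP[i]; rewrite fin_numE fgNy/= => /negPn/eqP h.
by rewrite (mean_eqy (i := i)).
Qed.

Lemma objective_fin x : objective r f g x \is a fin_num ->
  r x \is a fin_num /\ forall i, g i x \is a fin_num.
Proof.
rewrite /objective fin_numD => /andP[rx mx]; split=> // i.
by have := mean_fin_num (fun j => fgNy j x x) mx i; rewrite fin_numD => /andP[].
Qed.

Lemma objective_lagrangian x nu :
  lagrangian r f g x (fun=> x) nu = objective r f g x.
Proof.
rewrite /lagrangian [X in (_ + X)%E]mean_fin//= (eq_avg (G := fun=> 0)).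
  by rewrite avg_cst// adde0.
by move=> i; rewrite subrr dot0r.
Qed.

Lemma lagrangian_fin x xx nu : r x \is a fin_num ->
  (forall i, g i (xx i) \is a fin_num) ->
  lagrangian r f g x xx nu = (fine (r x) +
    avg (fun i => fine (f i (xx i)) + fine (g i (xx i)) +
      dot (nu i) (xx i - x)))%:E.
Proof.
move=> rx gx; have fgfin i : (f i (xx i) + g i (xx i))%E \is a fin_num.
  by rewrite fin_numD ffin gx.
rewrite /lagrangian !mean_fin// -(fineK rx) -!EFinD/= -addrA -avgD.
by congr (_ + _)%:E; apply: eq_avg => i; rewrite fineD.
Qed.

(** Since the multipliers are free, maximality in them forces the copies [xx i]
    to agree with [x]. The value of the Lagrangian is then the objective at [x],
    hence at [xstar], so that [xstar] inherits the minimality. *)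
Lemma saddle_at_solution xstar x xx nu : saddle_point r f g x xx nu ->
  argmin (objective r f g) xstar ->
  objective r f g xstar \is a fin_num /\
  forall x' xx',
    (lagrangian r f g xstar (fun=> xstar) nu <= lagrangian r f g x' xx' nu)%E.
Proof.
move=> [maxnu minx] opt.
have [_ _ [_ [w rw]]] := ccpr.
have /choice[ww gw] : forall i, exists w, (g i w < +oo)%E.
  by move=> i; case: (ccpg i) => _ _ [].
have wfin : r w \is a fin_num by rewrite fin_numE rNy -ltey rw.
have wwfin i : g i (ww i) \is a fin_num by rewrite fin_numE gNy -ltey gw.
have Lfin : lagrangian r f g x xx nu != +oo%E.
  rewrite -ltey; apply: le_lt_trans (minx w ww) _.
  by rewrite lagrangian_fin// ltey.
have dotfin : mean (fun i => (dot (nu i) (xx i - x))%:E) \is a fin_num.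
  by rewrite mean_fin.
have /andP[rx gx] : (r x \is a fin_num) &&
    (mean (fun i => f i (xx i) + g i (xx i))%E \is a fin_num).
  rewrite !fin_numE rNy mean_sumNy/=; apply/andP.
  move: Lfin; rewrite /lagrangian -(fineK dotfin).
  have := rNy x; have := mean_sumNy xx.
  by case: (r x) (mean _) => [?| |] [?| |].
have {}gx i : g i (xx i) \is a fin_num.
  have := mean_fin_num (fun j => fgNy j _ _) gx i.
  by rewrite fin_numD => /andP[].
have xxE i : xx i = x.
  (* Shifting the multipliers by the deviations raises the Lagrangian by the
     average of the squared deviations. *)
  have := maxnu (fun i => nu i + (xx i - x)).
  rewrite !lagrangian_fin// lee_fin lerD2l -subr_ge0 -avgB => dev.
  have dev0 j : 0 <= dot (xx j - x) (xx j - x) by exact: dot_ge0.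
  have : \sum_j dot (xx j - x) (xx j - x) <= 0.
    rewrite -oppr_ge0 -sumrN.
    rewrite -(pmulr_rge0 _ (_ : 0 < n%:R^-1)) ?invr_gt0 ?ltr0n//.
    by apply: le_trans dev _; apply: ler_avg => j; rewrite dotDl; lra.
  rewrite le_eqVlt ltNge sumr_ge0// orbF psumr_eq0// => /allP/(_ i).
  rewrite mem_index_enum => /(_ isT)/= /eqP/dot_eq0/eqP.
  by rewrite subr_eq0 => /eqP.
have xx_eq : xx = fun=> x by apply/funext.
have objE : lagrangian r f g x xx nu = objective r f g x.
  by rewrite xx_eq objective_lagrangian.
split.
- have [Nx _] : objective r f g xstar != -oo%E /\ True.
    split=> //; rewrite /objective adde_eq_ninfty negb_or rNy.
    exact: (mean_sumNy (fun=> xstar)).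
  by rewrite fin_numE Nx/= -ltey (le_lt_trans (opt x))// -objE ltey.
- by move=> x' xx'; rewrite objective_lagrangian (le_trans (opt x))// -objE.
Qed.

(** Varying only the common variable, or only one copy, in the minimality of the
    saddle point separates it into one condition for [r] and one for each
    [f i + g i]; in the latter [f i] is replaced by its gradient. *)
Lemma dual_certificate xstar : (exists x xx nu, saddle_point r f g x xx nu) ->
  argmin (objective r f g) xstar ->
  exists nu : 'I_n -> 'rV[R]_d,
    subgradient r xstar (n%:R^-1 *: \sum_i nu i) /\
    forall i, subgradient (g i) xstar (- (grad (f i) xstar + nu i)).
Proof.
move=> [x [xx [nu saddle]]] opt; exists nu.
have [/objective_fin[rx gx] sad] := saddle_at_solution saddle opt.
split.
- split=> // y; have [ry|] := boolP (r y \is a fin_num); last first.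
    rewrite fin_numE rNy/= => /negPn/eqP ->; exact: leey.
  have := sad y (fun=> xstar).
  rewrite !lagrangian_fin// -(fineK rx) -(fineK ry) -EFinD !lee_fin.
  have -> : avg (fun i => fine (f i xstar) + fine (g i xstar) +
      dot (nu i) (xstar - xstar)) =
      avg (fun i => fine (f i xstar) + fine (g i xstar)).
    by apply: eq_avg => i; rewrite subrr dot0r addr0.
  have -> : avg (fun i => fine (f i xstar) + fine (g i xstar) +
      dot (nu i) (xstar - y)) =
      avg (fun i => fine (f i xstar) + fine (g i xstar)) -
      avg (fun i => dot (nu i) (y - xstar)).
    by rewrite -avgB; apply: eq_avg => i; rewrite -[xstar - y]opprB dotNr.
  by rewrite dot_avgl; lra.
- move=> i; have [cvx _ _] := ccpg i.
  apply: (@minimizer_subgradient _ _ _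
    (fun y => fine (f i y) + dot (nu i) (y - xstar)) _ _ (2^-1 * L)) => //.
  + move=> y; have [gy|] := boolP (g i y \is a fin_num); last first.
      rewrite fin_numE gNy/= => /negPn/eqP ->; rewrite addye//; exact: leey.
    pose yy j := if j == i then y else xstar.
    have gyy j : g j (yy j) \is a fin_num.
      by rewrite /yy; case: eqP => [->|].
    have := sad xstar yy; rewrite !lagrangian_fin// !lee_fin lerD2l.
    rewrite -subr_ge0 -avgB pmulr_rge0 ?invr_gt0 ?ltr0n// (bigD1 i)//=.
    rewrite big1 => [|j /negPf ji]; last by rewrite /yy ji subrr.
    rewrite /yy eqxx -(fineK (gx i)) -(fineK gy) -!EFinD lee_fin; lra.
  + move=> y; have := smooth_bound (df i) (lipf i) xstar y.
    rewrite ler_norml => /andP[_].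
    by rewrite /= subrr dot0r (dotDl (grad _ _)); lra.
Qed.

End SaddlePoint.

(** * One iteration *)

Ltac row_ring := apply/rowP => ?; rewrite !mxE; ring.

Section Iteration.
Context {R : realType} {d n : nat}.
Variables (r : 'rV[R]_d -> \bar R) (f g : 'I_n -> 'rV[R]_d -> \bar R).
Variables (L alpha : R) (z : nat -> 'I_n -> 'rV[R]_d) (xh : nat -> 'rV[R]_d).
Variables (xs : nat -> 'I_n -> 'rV[R]_d) (xstar : 'rV[R]_d).
Variable nu : 'I_n -> 'rV[R]_d.
Hypotheses (n0 : (0 < n)%N) (ccpr : ccp r) (ccpf : forall i, ccp (f i)).
Hypotheses (ccpg : forall i, ccp (g i)).
Hypothesis df : forall i, differentiable_fun (f i).
Hypothesis lipf : forall i, lipschitz_grad L (f i).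
Hypotheses (L0 : 0 < L) (alpha0 : 0 < alpha) (alpha_lt : alpha < 2 / L).
Hypothesis ppg : PPG r f g alpha z xh xs.
Hypothesis nur : subgradient r xstar (n%:R^-1 *: \sum_i nu i).
Hypothesis nug :
  forall i, subgradient (g i) xstar (- (grad (f i) xstar + nu i)).

Let G k i := grad (f i) (xh k) - grad (f i) xstar.

(** At a fixed point of the iteration with [xh k = xstar], optimality of the
    proximal steps forces [z k i = xstar + alpha *: nu i]. *)
Let delta k i := z k i - (xstar + alpha *: nu i).

Let V k := avg (fun i => 2^-1 * dot (delta k i) (delta k i)).

Let decay := alpha / L - 2^-1 * alpha ^+ 2.

Let ffin i x : f i x \is a fin_num. Proof. by case: (df i x). Qed.

Let alphaN0 : alpha != 0. Proof. by rewrite gt_eqF. Qed.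

Lemma decay_gt0 : 0 < decay.
Proof.
have -> : decay = 2^-1 * alpha * (2 / L - alpha).
  by rewrite /decay; field; rewrite gt_eqF.
by rewrite !mulr_gt0 ?invr_gt0 ?subr_gt0.
Qed.

Lemma xsE k i : xs k.+1 i = xh k + (z k.+1 i - z k i).
Proof.
have [_ _ ->] := ppg k; row_ring.
Qed.

Lemma iter_subgradient_r k :
  subgradient r (xh k) (alpha^-1 *: (n%:R^-1 *: \sum_i (z k i - xh k))).
Proof.
have [/(prox_subgradient alpha0 ccpr) + _ _] := ppg k.
congr (subgradient _ _ (_ *: _)); rewrite sumrB scalerBr sumr_const card_ord.
by rewrite -[xh k *+ n]scaler_nat scalerA mulVf ?scale1r// pnatr_eq0 -lt0n.
Qed.

Lemma iter_subgradient_g k i : subgradient (g i) (xs k.+1 i)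
  (alpha^-1 *: (xh k - z k.+1 i - alpha *: grad (f i) (xh k))).
Proof.
have [_ /(_ i)/(prox_subgradient alpha0 (ccpg i)) + _] := ppg k.
congr (subgradient _ _ (_ *: _)); rewrite xsE; row_ring.
Qed.

(** Monotonicity of the subgradients of [r] and of the [g i] between the
    iterates and [xstar], averaged over the blocks, feeds [fejer_term]. *)
Lemma fejer k :
  decay * avg (fun i => dot (G k i) (G k i)) <= V k - V k.+1.
Proof.
have mr := subgradient_monotone (iter_subgradient_r k) nur.
have mg i := subgradient_monotone (iter_subgradient_g k i) (nug i).
pose w i := z k.+1 i - z k i; pose xi := xh k - xstar.
have dE i : delta k.+1 i = delta k i + w i.
  by rewrite /delta /w [RHS]addrC addrA subrK.
have : 0 <= avg (fun i => dot (delta k i - xi) xi +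
    dot (xi - delta k i - w i - alpha *: G k i) (xi + w i)).
  rewrite avgD addr_ge0//.
    have := mulr_ge0 (ltW alpha0) mr; rewrite dotDl dotNl mulrBr dotZl mulVKf//.
    rewrite !dot_avgl -avgZ -avgB; congr (0 <= _); apply: eq_avg => i.
    rewrite -dotZl -dotNl -dotDl; congr (dot _ _).
    by rewrite /delta /xi; row_ring.
  apply: avg_ge0 => i; have := mulr_ge0 (ltW alpha0) (mg i).
  rewrite -dotZl scalerBr scalerA mulfV// scale1r xsE.
  congr (0 <= dot _ _); rewrite /delta /xi /w /G; row_ring.
move/le_trans => /(_ (V k - V k.+1 -
  decay * avg (fun i => dot (G k i) (G k i)))).
rewrite subr_ge0; apply.
rewrite /V -avgZ -!avgB; apply: ler_avg => i; rewrite dE.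
apply: fejer_term => //; exact: grad_cocoercive.
Qed.

Lemma V_ge0 k : 0 <= V k.
Proof. by apply: avg_ge0 => i; rewrite mulr_ge0 ?invr_ge0 ?dot_ge0. Qed.

Lemma V_le k : (0 < k)%N -> V k <= V 1.
Proof.
case: k => // k _; elim: k => // k; apply: le_trans.
rewrite -subr_ge0; apply: le_trans (fejer k.+1).
rewrite mulr_ge0 ?(ltW decay_gt0)//.
by apply: avg_ge0 => i; exact: dot_ge0.
Qed.

(** In mean square, [z k] is no farther from the fixed point than [z 1]. *)
Lemma drift_bound k : (0 < k)%N ->
  avg (fun i => 2^-1 * dot (z k i - z 1 i) (z k i - z 1 i)) <= 4 * V 1.
Proof.
move=> k0; apply: (@le_trans _ _ (2 * V k + 2 * V 1)); last first.
  by have := V_le k0; lra.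
rewrite /V -!avgZ -avgD; apply: ler_avg => i.
have -> : z k i - z 1 i = delta k i - delta 1 i.
  by rewrite /delta; row_ring.
move: (delta k i) (delta 1 i) => u v; have := dot_ge0 (u + v).
by rewrite !dotL (dotC v u); lra.
Qed.

Let gap k := fine (r (xh k)) - fine (r xstar) +
  avg (fun i => fine (f i (xh k)) - fine (f i xstar) +
                (fine (g i (xs k.+1 i)) - fine (g i xstar))).

(** The first average is the potential whose decrease [gap_term] provides. The
    coefficient of [V] is chosen so that the decrease of [V] pays for the
    squared gradient differences left over there. *)
Let Phi k := avg (fun i => 2^-1 * dot (z k i - xstar) (z k i - xstar) +
    alpha * dot (grad (f i) xstar) (z k i)) +
  2^-1 * alpha ^+ 2 / decay * V k.

Lemma gap_le k : alpha * gap k <= Phi k - Phi k.+1.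
Proof.
have sr := subgradient_fine (iter_subgradient_r k) nur.1.
have sg i := subgradient_fine (iter_subgradient_g k i) (nug i).1.
have sf i := subgradient_fine
  (grad_subgradient (ccpf i) (df i) (lipf i) (xh k)) (ffin i xstar).
pose w i := z k.+1 i - z k i; pose xi := xh k - xstar.
pose e i := z k i - xstar; pose D i := grad (f i) (xh k).
have step1 : alpha * gap k <= avg (fun i => dot (e i - xi) xi +
    (alpha * dot (D i) xi + dot (xi - e i - w i - alpha *: D i) (xi + w i))).
  rewrite /gap mulrDr.
  rewrite [leRHS]avgD lerD//.
    have := ler_wpM2l (ltW alpha0) sr.
    rewrite dotZl -[xstar - xh k]opprB dotNr mulrDr mulrN mulrN mulVKf//.
    rewrite dot_avgl -/xi.
    rewrite (@eq_avg _ _ (fun i => dot (z k i - xh k) xi)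
      (fun i => dot (e i - xi) xi)).
      by lra.
    move=> i; congr (dot _ _); rewrite /e /xi.
    by row_ring.
  rewrite -avgZ; apply: ler_avg => i; rewrite mulrDr lerD//.
    have := ler_wpM2l (ltW alpha0) (sf i).
    by rewrite -[xstar - xh k]opprB dotNr mulrDr -/xi /D; lra.
  have := ler_wpM2l (ltW alpha0) (sg i).
  rewrite dotZl mulrDr mulVKf// xsE -/(w i).
  have -> : xi - e i - w i - alpha *: D i =
     xh k - z k.+1 i - alpha *: grad (f i) (xh k).
    by rewrite /xi /e /w /D; row_ring.
  have -> : xstar - (xh k + w i) = - (xi + w i).
    by rewrite /xi; row_ring.
  by rewrite dotNr; lra.
have step2 := ler_avg (fun i =>
  gap_term alpha (e i) xi (w i) (D i) (grad (f i) xstar)).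
apply: le_trans step1 (le_trans step2 _).
have M0 : 0 <= 2^-1 * alpha ^+ 2 / decay.
  by rewrite divr_ge0 ?(ltW decay_gt0)// mulr_ge0 ?invr_ge0 ?sqr_ge0.
have := ler_wpM2l M0 (fejer k).
rewrite mulrA divfK ?(gt_eqF decay_gt0)// -avgZ => step3.
rewrite avgD /Phi opprD addrACA -avgB -mulrBr lerD//.
rewrite le_eqVlt; apply/orP; left; apply/eqP; apply: eq_avg => i.
have -> : z k.+1 i - xstar = e i + w i by rewrite /e /w; row_ring.
by rewrite -/(e i) /w dotDr dotNr; ring.
Qed.

(** The square dominates the linear term of the potential. *)
Lemma Phi_lower : exists B, forall k, B <= Phi k.
Proof.
exists (avg (fun i => alpha * dot (grad (f i) xstar) xstar -
  2^-1 * alpha ^+ 2 * dot (grad (f i) xstar) (grad (f i) xstar))) => k.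
rewrite /Phi -[leLHS]addr0 lerD//; last first.
  apply: mulr_ge0 (V_ge0 k).
  by rewrite divr_ge0 ?(ltW decay_gt0)// mulr_ge0 ?invr_ge0 ?sqr_ge0.
apply: ler_avg => i.
have := dot_ge0 (z k i - xstar + alpha *: grad (f i) xstar).
rewrite -[in dot _ (z k i)](subrK xstar (z k i)).
move: (z k i - xstar) => v; rewrite !dotL (dotC v (grad _ _)); nra.
Qed.

(** * Ergodic rates *)

Let gap_erg k := fine (r (xh_erg xh k)) - fine (r xstar) +
  avg (fun i => fine (f i (xh_erg xh k)) - fine (f i xstar) +
                (fine (g i (xs_erg xs k i)) - fine (g i xstar))).

Lemma jensen_r k : (0 < k)%N -> r (xh_erg xh k) \is a fin_num /\
  fine (r (xh_erg xh k)) <= k%:R^-1 * \sum_(1 <= j < k.+1) fine (r (xh j)).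
Proof.
case: ccpr => cvx _ [rNy _] k0.
by apply: jensen_erg => // j; have [] := iter_subgradient_r j.
Qed.

Lemma jensen_g k i : (0 < k)%N -> g i (xs_erg xs k i) \is a fin_num /\
  fine (g i (xs_erg xs k i)) <=
    k%:R^-1 * \sum_(1 <= j < k.+1) fine (g i (xs j.+1 i)).
Proof.
case: (ccpg i) => cvx _ [gNy _] k0.
apply: (jensen_erg (y := fun j => xs j.+1 i)) => // j.
by have [] := iter_subgradient_g j i.
Qed.

Lemma jensen_f k i : (0 < k)%N -> fine (f i (xh_erg xh k)) <=
  k%:R^-1 * \sum_(1 <= j < k.+1) fine (f i (xh j)).
Proof.
case: (ccpf i) => cvx _ [fNy _] k0.
exact: (jensen_erg cvx fNy (fun j => ffin i (xh j)) k0).2.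
Qed.

Lemma sumB_cst k (a : nat -> R) c : (0 < k)%N ->
  k%:R^-1 * \sum_(1 <= j < k.+1) a j - c =
  k%:R^-1 * \sum_(1 <= j < k.+1) (a j - c).
Proof.
move=> k0; rewrite sumrB mulrBr sumr_const_nat subSS subn0.
by rewrite -[c *+ k]mulr_natl mulKf// pnatr_eq0 -lt0n.
Qed.

Lemma gap_erg_upper : exists C, forall k, (0 < k)%N -> gap_erg k <= C * k%:R^-1.
Proof.
have [B PhiB] := Phi_lower; exists (alpha^-1 * (Phi 1 - B)) => k k0.
apply: (@le_trans _ _ (k%:R^-1 * \sum_(1 <= j < k.+1) gap j)).
  rewrite /gap big_split/= mulrDr lerD//.
    by rewrite -sumB_cst// lerD2r (jensen_r k0).2.
  rewrite -avg_sumr -avgZ; apply: ler_avg => i.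
  rewrite big_split mulrDr/= -!sumB_cst// lerD// lerD2r.
    exact: jensen_f.
  exact: (jensen_g i k0).2.
rewrite mulrC ler_wpM2r ?invr_ge0//.
rewrite -(ler_pM2l alpha0) mulVKf// mulr_sumr.
apply: (@le_trans _ _ (\sum_(1 <= j < k.+1) (Phi j - Phi j.+1))).
  by apply: ler_sum => j _; exact: gap_le.
rewrite -[leLHS]opprK -sumrN.
under eq_bigr do rewrite opprB.
by rewrite telescope_sumr// opprB lerD2l lerN2.
Qed.

(** Consecutive differences [xs j.+1 i - xh j] are the steps of [z], hence their
    sum telescopes. *)
Lemma erg_drift k i : xs_erg xs k i - xh_erg xh k =
  k%:R^-1 *: (z k.+1 i - z 1 i).
Proof.
rewrite /xs_erg /xh_erg -scalerBr -sumrB; congr (_ *: _).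
under eq_bigr do rewrite xsE addrAC subrr add0r.
by rewrite telescope_sumr.
Qed.

(** The subgradients at [xstar] provided by the multipliers add up so that only
    the disagreement between [xs_erg xs k i] and [xh_erg xh k] contributes. *)
Lemma gap_erg_lower : exists C, forall k, (0 < k)%N ->
  - (C * k%:R^-1) <= gap_erg k.
Proof.
pose s i := grad (f i) xstar + nu i.
exists (avg (fun i => 2^-1 * dot (s i) (s i)) + 4 * V 1) => k k0.
have kV : 0 <= k%:R^-1 :> R by rewrite invr_ge0.
have sr := subgradient_fine nur (jensen_r k0).1.
have sg i := subgradient_fine (nug i) (jensen_g i k0).1.
have sf i := subgradient_fine
  (grad_subgradient (ccpf i) (df i) (lipf i) xstar) (ffin i (xh_erg xh k)).
apply: (@le_trans _ _
    (avg (fun i => - (k%:R^-1 * dot (s i) (z k.+1 i - z 1 i))))).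
  rewrite avgN lerN2 avgZ [leRHS]mulrC ler_wpM2l//.
  apply: le_trans (lerD (lexx _) (drift_bound (ltn0Sn k))).
  by rewrite -avgD; apply: ler_avg => i; exact: young_dot.
rewrite dot_avgl in sr.
apply: (@le_trans _ _ (avg (fun i => dot (nu i) (xh_erg xh k - xstar)) +
  avg (fun i => dot (grad (f i) xstar) (xh_erg xh k - xstar) +
    dot (- s i) (xs_erg xs k i - xstar)))); last first.
  rewrite lerD//; first by lra.
  by apply: ler_avg => i; have := sf i; have := sg i; rewrite -/(s i); lra.
rewrite -avgD; apply: ler_avg => i; rewrite -dotZr -erg_drift /s.
have -> : xs_erg xs k i - xstar =
    (xs_erg xs k i - xh_erg xh k) + (xh_erg xh k - xstar) by row_ring.
by move: (_ - xh_erg _ _) (_ - xstar) => u v; rewrite !dotL; lra.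
Qed.

Lemma E_ergE k : (0 < k)%N -> E_erg r f g xh xs xstar k = (gap_erg k)%:E.
Proof.
move=> k0; have [rf _] := jensen_r k0.
have gf i : g i (xs_erg xs k i) \is a fin_num by have [] := jensen_g i k0.
have gs i : g i xstar \is a fin_num by have [] := nug i.
rewrite /E_erg /bar /bar_tuple !mean_fin// -(fineK rf) -(fineK nur.1).
rewrite -!EFinD/= /gap_erg avgD !avgB; congr _%:E; ring.
Qed.

(** Replacing [xs_erg xs k i] by [xh_erg xh k] in [g i] costs a Lipschitz
    constant times their distance, which is of order 1/k by [erg_drift]. *)
Lemma e_erg_le Lg : lipschitz_fun Lg (bar g) ->
  exists C, forall k, (0 < k)%N ->
    (e_erg r f g xh xstar k <= (gap_erg k + C * k%:R^-1)%:E)%E.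
Proof.
move=> lipg.
have gfin i x : g i x \is a fin_num.
  apply: (mean_fin_num (F := fun i => g i x)); last exact: lipg.1.
  by move=> j; case: (ccpg j) => _ _ [].
have cvx i : convex_fun (g i) by case: (ccpg i).
have [K gK] : exists K : 'I_n -> R, forall i p q,
    fine (g i q) - fine (g i p) <= K i * l2norm (q - p).
  eexists; exact: (summand_lipschitz n0 cvx gfin nug lipg).
exists (avg (fun i => 2^-1 * K i ^+ 2) + 4 * V 1) => k k0.
have [rf _] := jensen_r k0.
rewrite /e_erg /bar !mean_fin// -(fineK rf) -(fineK nur.1).
rewrite -!EFinD/= lee_fin /gap_erg avgD !avgB.
suff : avg (fun i => fine (g i (xh_erg xh k))) -
    avg (fun i => fine (g i (xs_erg xs k i))) <=
    (avg (fun i => 2^-1 * K i ^+ 2) + 4 * V 1) * k%:R^-1 by lra.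
have kV : 0 <= k%:R^-1 :> R by rewrite invr_ge0.
apply: le_trans (_ : _ <= (avg (fun i => 2^-1 * K i ^+ 2) + avg (fun i =>
  2^-1 * dot (z k.+1 i - z 1 i) (z k.+1 i - z 1 i))) * k%:R^-1) _; last first.
  by rewrite ler_wpM2r// lerD2l drift_bound.
rewrite -avgD -avgB mulrC -avgZ; apply: ler_avg => i.
apply: le_trans (gK i _ _) _.
rewrite -opprB erg_drift -scalerN l2normZ// mulrCA ler_wpM2l//.
set N := l2norm _; have -> : dot (z k.+1 i - z 1 i) (z k.+1 i - z 1 i) = N ^+ 2.
  by rewrite /N l2norm_sqr dotNl dotNr opprK.
by have := sqr_ge0 (K i - N); rewrite sqrrB; lra.
Qed.

End Iteration.

Lemma le_bigO_inv {R : realType} (a : nat -> \bar R) (C : R) :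
  (forall k, (0 < k)%N -> (a k <= (C * k%:R^-1)%:E)%E) ->
  le_bigO a (fun k => k%:R^-1).
Proof.
move=> aC; exists (fun k => C * k%:R^-1); last by exists 1%N.
apply/eqO_exP; exists (`|C| + 1); first by rewrite ltr_wpDl.
by near=> k; rewrite normrM ler_wpM2r// lerDl.
Unshelve. all: by end_near.
Qed.

Theorem theorem3 (R : realType) (d n : nat)
    (r : 'rV[R]_d -> \bar R) (f g : 'I_n -> 'rV[R]_d -> \bar R)
    (L alpha : R)
    (z : nat -> 'I_n -> 'rV[R]_d) (xh : nat -> 'rV[R]_d)
    (xs : nat -> 'I_n -> 'rV[R]_d) (xstar : 'rV[R]_d) :
  (0 < n)%N ->
  ccp r -> (forall i, ccp (f i)) -> (forall i, ccp (g i)) ->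
  (forall i, differentiable_fun (f i)) ->
  (forall i, lipschitz_grad L (f i)) ->
  (exists x xx nu, saddle_point r f g x xx nu) ->
  0 < alpha < 3 / (2 * L) ->
  PPG r f g alpha z xh xs ->
  argmin (objective r f g) xstar ->
  le_bigO (fun k => `|E_erg r f g xh xs xstar k|%E) (fun k => k%:R^-1)
  /\ (forall Lg : R, lipschitz_fun Lg (bar g) ->
      le_bigO (e_erg r f g xh xstar) (fun k => k%:R^-1)).
Proof.
move=> n0 ccpr ccpf ccpg df lipf saddle /andP[alpha0 alphaL] ppg opt.
(* The upper bound on [alpha] must be positive, which excludes [L <= 0]. *)
have L0 : 0 < L.
  have := lt_trans alpha0 alphaL.
  by rewrite pmulr_rgt0// invr_gt0 pmulr_rgt0.
have alpha_lt : alpha < 2 / L.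
  apply: lt_trans alphaL _.
  rewrite invfM mulrA ltr_pM2r ?invr_gt0//; lra.
have [nu [nur nug]] := dual_certificate n0 ccpr ccpg df lipf saddle opt.
have [Cu hi] :=
  gap_erg_upper n0 ccpr ccpf ccpg df lipf L0 alpha0 alpha_lt ppg nur nug.
have [Cl lo] :=
  gap_erg_lower n0 ccpr ccpf ccpg df lipf L0 alpha0 alpha_lt ppg nur nug.
split.
- apply: (@le_bigO_inv _ _ (`|Cu| + `|Cl|)) => k k0.
  have kV : 0 <= k%:R^-1 :> R by rewrite invr_ge0.
  rewrite (E_ergE n0 ccpr ccpg df alpha0 ppg nur nug k0) lee_fin ler_norml.
  have := hi k k0; have := lo k k0.
  have := ler_wpM2r kV (ler_norm Cu); have := ler_wpM2r kV (ler_norm Cl).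
  have := mulr_ge0 (normr_ge0 Cu) kV; have := mulr_ge0 (normr_ge0 Cl) kV.
  by move=> ? ? ? ? ? ?; apply/andP; split; lra.
- move=> Lg lipg.
  have [C eC] := e_erg_le
    n0 ccpr ccpf ccpg df lipf L0 alpha0 alpha_lt ppg nur nug lipg.
  apply: (@le_bigO_inv _ _ (Cu + C)) => k k0.
  by apply: le_trans (eC k k0) _; rewrite lee_fin mulrDl lerD2r hi.
Qed.
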